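(* Let $p,r,n\geq1$. Then: (a) if $r=1$ and $p\geq1$, then $\delta(I\Gamma_{n}^{(p,r)})=\lceil \frac{n}{2p+1}\rceil$; (b) if $r\geq2$ and $p=1$, then with $t=n\bmod (r+2)$, $\delta(I\Gamma_{n}^{(p,r)})=r\lfloor\frac{n}{r+2}\rfloor+t$ if $0\leq t\leq r-1$, and $\delta(I\Gamma_{n}^{(p,r)})=r\lfloor\frac{n}{r+2}\rfloor+r$ if $t\in\{r,r+1\}$; (c) if $r\geq2$ and $p\geq2$, then with $t=n\bmod (2p+r)$, $\delta(I\Gamma_{n}^{(p,r)})=2\lfloor\frac{n}{r+2p}\rfloor+t$ if $t\in\{0,1\}$, and $\delta(I\Gamma_{n}^{(p,r)})=2\lfloor\frac{n}{r+2p}\rfloor+2$ if $2\leq t\leq r+2p-1$.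
   Context: For positive integers $n,p,r$, $I\Gamma_{n}^{(p,r)}$ is the graph whose vertices are the binary words of length $n$ in which every maximal block of consecutive $1$s has length at most $r$ and any two distinct blocks of $1$s are separated by at least $p$ zeros; two vertices are adjacent iff they differ in exactly one coordinate. $\delta(G)$ denotes the minimum degree of $G$. *)

(* Defs.v *)
From mathcomp Require Import all_boot all_order all_algebra.

Set Implicit Arguments.
Unset Strict Implicit.
Unset Printing Implicit Defensive.

Record sgraph := SGraph {
  vertex :> finType;
  adj : rel vertex;
  adj_sym : symmetric adj;
  adj_irrefl : irreflexive adj }.

Definition degree (G : sgraph) (x : G) : nat := #|[set y : G | adj x y]|.

(* The default value #|G| only matters for the graph without vertices: in a
   simple graph every degree is smaller than #|G|. *)
Definition min_degree (G : sgraph) : nat := \big[minn/#|G|]_(x : G) degree x.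

(* The positions i, i+1, ..., j-1 form a maximal block of consecutive 1s of w.
   Letters are numbered from 0, and the letter at position [size w], past the
   end of w, reads as [false]. *)
Definition one_block (w : seq bool) (i j : nat) : bool :=
  [&& i < j <= size w, all (nth false w) (iota i (j - i)),
      (i == 0) || ~~ nth false w i.-1 & ~~ nth false w j].

Definition zeros_between (w : seq bool) (j k : nat) : nat :=
  count negb (drop j (take k w)).

Definition IG_word (n p r : nat) (w : n.-tuple bool) : bool :=
  [forall i : 'I_n.+1, forall j : 'I_n.+1, one_block w i j ==> (j - i <= r)]
  && [forall i : 'I_n.+1, forall j : 'I_n.+1,
      forall k : 'I_n.+1, forall l : 'I_n.+1,
      [&& one_block w i j, one_block w k l & i < k]
        ==> (p <= zeros_between w j k)].

Definition IG_vertex (n p r : nat) : finType :=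
  {w : n.-tuple bool | IG_word p r w}.

Definition IG_adj (n p r : nat) : rel (IG_vertex n p r) :=
  fun u v => #|[set i : 'I_n | tnth (val u) i != tnth (val v) i]| == 1.

Lemma IG_adj_sym (n p r : nat) : symmetric (@IG_adj n p r).
Proof.
by move=> u v; congr (_ == _); apply: eq_card => i; rewrite !inE eq_sym.
Qed.

Lemma IG_adj_irrefl (n p r : nat) : irreflexive (@IG_adj n p r).
Proof.
by move=> u; rewrite /IG_adj eq_card0 // => i; rewrite !inE eqxx.
Qed.

Definition IG (n p r : nat) : sgraph :=
  SGraph (@IG_adj_sym n p r) (@IG_adj_irrefl n p r).

(* Main.v *)
(* In the word 0^p 1^r 0^p 0^p 1^r 0^p ... every 0 is within distance p of a
   full block, a block of r ones, so it cannot be turned into a 1; after choosing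
   the tail suitably, this word has the smallest degree.

   For the converse, count the positions of a word at which flipping the letter
   leaves a legal word. Both ends of every block, all ones if p = 1, and every 0
   at distance more than p from all ones are such positions, as are the zeros
   next to a block of fewer than r ones when the adjacent gap is wider than p.
   Scanning the blocks from left to right, one bounds the length of the prefix
   read so far by a function of the number of flippable positions found in it. *)
Require Import Defs.
From mathcomp Require Import all_boot all_order all_algebra.
From mathcomp Require Import zify.

Set Implicit Arguments.
Unset Strict Implicit.
Unset Printing Implicit Defensive.

(** * Words as functions on positions *)

(** Block-free form of the vertex condition, so that the effect of a flip can be checked position by
    position. Two blocks separated by fewer than [p] zeros contain two ones at distance at most [p]
    with a 0 between them. *)
Definition valid (p r : nat) (f : nat -> bool) : Prop :=
  (forall i, exists2 k, k <= r & ~~ f (i + k)) /\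
  (forall i m j, i < m -> m < j -> j <= i + p -> f i -> f j -> f m).

Definition flip (f : nat -> bool) (i : nat) : nat -> bool :=
  fun k => f k (+) (k == i).

Definition block (f : nat -> bool) (a b : nat) : Prop :=
  [/\ a < b, forall k, a <= k < b -> f k, a = 0 \/ ~~ f a.-1 & ~~ f b].

Lemma run_start (f : nat -> bool) i :
  exists a, [/\ a <= i, forall k, a <= k < i -> f k & a = 0 \/ ~~ f a.-1].
Proof.
elim: i => [|i [a [le_ai ones_a start_a]]]; first by exists 0; split=> //; left.
case fi: (f i); last by exists i.+1; split=> //=; [lia | right; rewrite fi].
exists a; split=> //; first lia.
move=> k ak; have [->//|ki] := eqVneq k i; apply: ones_a; lia.
Qed.

Lemma run_end (f : nat -> bool) n i : ~~ f n -> i <= n ->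
  exists b, [/\ i <= b <= n, forall k, i <= k < b -> f k & ~~ f b].
Proof.
move=> fn le_in.
have ex : exists m, ~~ f (i + m) by exists (n - i); rewrite subnKC.
case: (ex_minnP ex) => m fm min_m; exists (i + m); split=> //.
  have := min_m (n - i); rewrite subnKC // => /(_ fn); lia.
move=> k ik; apply/negPn/negP => fk.
have := min_m (k - i); rewrite subnKC; last lia.
move=> /(_ fk); lia.
Qed.

Lemma last_block f m : ~~ f m ->
  (forall k, k <= m -> ~~ f k) \/
  exists a b, [/\ block f a b, b <= m & forall k, b <= k <= m -> ~~ f k].
Proof.
move=> fm.
have [b [le_bm zero_b start_b]] := run_start (negb \o f) m.
have zero k : b <= k <= m -> ~~ f k.
  by move=> bk; have [->//|km] := eqVneq k m; apply: zero_b; lia.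
case: (posnP b) => [b0|b_gt0]; first by left=> k km; apply: zero; lia.
right; have fb : f b.-1 by case: start_b => [|/negPn//]; lia.
have [a [le_ab ones_a start_a]] := run_start f b.
exists a, b; split=> //; split=> //; last by apply: zero; lia.
rewrite ltn_neqAle le_ab andbT; apply/eqP => ab.
case: start_a => [|/negP]; [lia | by rewrite ab].
Qed.

Lemma prev_block f a b : block f a b ->
  (forall k, k < a -> ~~ f k) \/
  exists a' b', [/\ block f a' b', b' < a & forall k, b' <= k < a -> ~~ f k].
Proof.
case=> _ _ start_a _; case: (posnP a) => [->|a_gt0]; first by left.
have fa : ~~ f a.-1 by case: start_a => // a0; lia.
case: (last_block fa) => [zero|[a' [b' [bl le zero]]]].
  by left=> k ka; apply: zero; lia.
by right; exists a', b'; split=> // [|k bk]; [lia | apply: zero; lia].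
Qed.

Lemma drop_take_nth (w : seq bool) j k : j <= k -> k <= size w ->
  drop j (take k w) = [seq nth false w i | i <- iota j (k - j)].
Proof.
move=> jk kw; rewrite map_nth_iota; last lia.
by rewrite take_drop subnK.
Qed.

Lemma one_blockP (w : seq bool) i j : j <= size w ->
  reflect (block (nth false w) i j) (one_block w i j).
Proof.
move=> jw; apply: (iffP and4P) => [[/andP[ij _] /allP ones st en]|[ij ones st en]].
  split=> // [k ik|]; first by apply: ones; rewrite mem_iota; lia.
  by case/orP: st => [/eqP|]; [left|right].
split=> //; first by rewrite ij.
  by apply/allP => k; rewrite mem_iota => ik; apply: ones; lia.
by case: st => [->|->]; rewrite ?orbT.
Qed.

Lemma IG_wordP n p r (w : n.-tuple bool) :
  reflect (valid p r (nth false w)) (IG_word p r w).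
Proof.
set f := nth false w.
have f_out k : n <= k -> ~~ f k by move=> nk; rewrite /f nth_default ?size_tuple.
have f_in k : f k -> k < n.
  by move=> fk; rewrite ltnNge; apply/negP => /f_out; rewrite fk.
have bl_le a b : block f a b -> b <= n.
  by case=> ab ones _ _; have := f_in b.-1; rewrite ones; lia.
apply: (iffP andP) => [[/forallP short /forallP apart]|[short apart]].
  have shortP a b : block f a b -> b - a <= r.
    move=> bl; have bn := bl_le _ _ bl; have ab : a < b by case: bl.
    have an : a < n.+1 by lia.
    have := forallP (short (Ordinal an)) (Ordinal (bn : b < n.+1)).
    by move=> /implyP /=; apply; apply/one_blockP; rewrite ?size_tuple.
  have apartP a b c d : block f a b -> block f c d -> a < c ->
      p <= zeros_between w b c.
    move=> bl1 bl2 ac; have bn := bl_le _ _ bl1; have dn := bl_le _ _ bl2.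
    have cd : c < d by case: bl2.
    have an : a < n.+1 by lia.
    have cn : c < n.+1 by lia.
    have := forallP (forallP (forallP (apart (Ordinal an))
      (Ordinal (bn : b < n.+1))) (Ordinal cn)) (Ordinal (dn : d < n.+1)).
    move=> /implyP /=; apply; apply/and3P; split=> //;
      by apply/one_blockP; rewrite ?size_tuple.
  split=> [i|i m j im mj jip fi fj].
    have [i_lt|i_ge] := ltnP i n; last by exists 0; rewrite ?f_out //; lia.
    have [a [ai ones_a start_a]] := run_start f i.
    have [b [/andP[ib bn] ones_b end_b]] := run_end (f_out n (leqnn n)) (ltnW i_lt).
    have [bi|bi] := ltnP i b; last by exists 0 => //; have ->: i + 0 = b by lia.
    have /shortP ba : block f a b.
      split=> //; first lia.
      by move=> k ak; have [ki|ki] := ltnP k i; [apply: ones_a|apply: ones_b]; lia.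
    by exists (b - i); [lia | rewrite subnKC].
  apply/negPn/negP => fm.
  have [b [ib ones_b end_b]] := run_end fm (ltnW im).
  have [a [ai ones_a start_a]] := run_start f i.
  have [c [cj ones_c start_c]] := run_start f j.
  have jn := f_in _ fj.
  have [d [/andP[jd dn] ones_d end_d]] := run_end (f_out n (leqnn n)) (ltnW jn).
  have ib' : i != b by apply/eqP => eib; move: end_b; rewrite -eib fi.
  have jd' : j != d by apply/eqP => ejd; move: end_d; rewrite -ejd fj.
  have mc : m < c.
    by rewrite ltnNge; apply/negP => cm; move: fm; rewrite ones_c //; lia.
  have bl1 : block f a b.
    split=> //; first lia.
    by move=> k ak; have [ki|ki] := ltnP k i; [apply: ones_a|apply: ones_b]; lia.
  have bl2 : block f c d.
    split=> //; first lia.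
    by move=> k ak; have [ki|ki] := ltnP k j; [apply: ones_c|apply: ones_d]; lia.
  (* The count of zeros is at most [c - b], which is below [p] because [j <= i + p]. *)
  have := apartP _ _ _ _ bl1 bl2; rewrite /zeros_between drop_take_nth ?size_tuple; try lia.
  have := count_size negb [seq nth false w i | i <- iota b (c - b)].
  rewrite size_map size_iota; lia.
split.
  apply/forallP => -[a an]; apply/forallP => -[b bn]; apply/implyP => /=.
  move=> /one_blockP; rewrite size_tuple => /(_ _) [//|ab ones _ _] /=.
  rewrite -/f in ones *; rewrite leqNgt; apply/negP => rab.
  have [k kr /negP] := short a; apply; apply: ones; lia.
apply/forallP => -[a an]; apply/forallP => -[b bn].
apply/forallP => -[c cn]; apply/forallP => -[d dn]; apply/implyP => /=.
case/and3P=> /one_blockP; rewrite size_tuple => /(_ _) [//|ab ones1 _ end_b].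
move=> /one_blockP; rewrite size_tuple => /(_ _) [//|cd ones2 start_c _] /= ac.
rewrite -/f in ones1 end_b ones2 start_c.
have fc : f c by apply: ones2; lia.
have fc1 : ~~ f c.-1 by case: start_c; lia.
have bc : b < c.
  rewrite ltnNge; apply/negP => cb; have [ecb|ncb] := eqVneq c b.
    by move: end_b; rewrite -ecb fc.
  by move: fc1; rewrite ones1 //; lia.
(* The two blocks need not be consecutive: the run of zeros from [e] to [c] alone already has [p]
   letters. *)
have [e [ec zeros_e start_e]] := run_start (negb \o f) c.
have be : b <= e.
  rewrite leqNgt; apply/negP => eb.
  by have /= := zeros_e b.-1; rewrite ones1; lia.
have fe1 : f e.-1 by case: start_e => [|/negPn //]; lia.
have ne : e < c.
  rewrite ltn_neqAle ec andbT; apply/eqP => ece.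
  by move: fc1; rewrite -ece fe1.
have pe : p <= c - e.
  rewrite leqNgt; apply/negP => lt.
  have /= := zeros_e e; rewrite (apart e.-1 e c) //; lia.
rewrite /zeros_between drop_take_nth ?size_tuple; try lia.
have -> : c - b = (e - b) + (c - e) by lia.
rewrite iotaD map_cat count_cat subnKC //.
suff -> : count negb [seq nth false w i | i <- iota e (c - e)] = c - e by lia.
rewrite count_map -[RHS](size_iota e); apply/eqP; rewrite -all_count.
by apply/allP => k; rewrite mem_iota => ek; apply: zeros_e; lia.
Qed.

(** * Flips and vertex degrees *)

Definition flip_tuple n (w : n.-tuple bool) (i : 'I_n) : n.-tuple bool :=
  [tuple tnth w j (+) (j == i) | j < n].

Lemma nth_flip_tuple n (w : n.-tuple bool) (i : 'I_n) :
  nth false (flip_tuple w i) =1 flip (nth false w) i.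
Proof.
move=> k; rewrite /flip; have [kn|nk] := ltnP k n.
  rewrite -(tnth_nth _ _ (Ordinal kn)) tnth_mktuple (tnth_nth false) /=.
  by congr (_ (+) _).
by rewrite !nth_default ?size_tuple //; have := ltn_ord i; case: eqP => //; lia.
Qed.

Lemma flip_tuple_inj n (w : n.-tuple bool) : injective (flip_tuple w).
Proof.
move=> i j /(congr1 (fun v => tnth v i)); rewrite !tnth_mktuple eqxx.
by move/addbI/esym/eqP.
Qed.

(** Extended by [false] past the end of the word, so that flips can be counted over prefixes. *)
Definition flippable p r n (w : n.-tuple bool) (k : nat) : bool :=
  oapp (fun i => IG_word p r (flip_tuple w i)) false (insub k : option 'I_n).

Lemma eq_valid p r f g : f =1 g -> valid p r f -> valid p r g.
Proof.
move=> fg [short apart]; split=> [i|i m j]; last by rewrite -!fg; apply: apart.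
by have [k kr] := short i; exists k; rewrite -?fg.
Qed.

Lemma flippableP p r n (w : n.-tuple bool) k :
  reflect (k < n /\ valid p r (flip (nth false w) k)) (flippable p r w k).
Proof.
rewrite /flippable; case: insubP => [i _ <-|] /=; last first.
  by rewrite -leqNgt => nk; right=> -[]; lia.
apply: (iffP (IG_wordP _ _ _)) => [v|[_ v]].
  by split=> //; apply: eq_valid v; apply: nth_flip_tuple.
by apply: eq_valid v => m; rewrite nth_flip_tuple.
Qed.

(** A neighbour differs from [u] at one position, so it is the flip of [u] there, and different
    positions give different flips. *)
Lemma degree_flippable p r n (u : IG n p r) :
  degree u = count (flippable p r (val u)) (iota 0 n).
Proof.
rewrite /degree -val_enum_ord count_map -size_filter.
transitivity #|[set i : 'I_n | IG_word p r (flip_tuple (val u) i)]|; last first.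
  rewrite cardsE cardE {1}/enum_mem -enumT.
  congr (size _); apply: eq_filter => i /=.
  by rewrite /flippable valK.
rewrite -(card_imset _ (@flip_tuple_inj _ (val u))) -(card_imset _ val_inj).
apply: eq_card => w; apply/imsetP/imsetP => [[v]|[i]].
  rewrite inE /= /IG_adj => /cards1P [i Ei] ->.
  have Ev : val v = flip_tuple (val u) i.
    apply: eq_from_tnth => j; rewrite tnth_mktuple.
    have : (j \in [set i0 | tnth (val u) i0 != tnth (val v) i0]) = (j == i).
      by rewrite Ei inE.
    by rewrite inE; case: (j == i); do 2!case: (tnth _ j).
  by exists i; rewrite // inE -Ev; apply: (valP v).
rewrite inE => vi ->; exists (exist _ (flip_tuple (val u) i) vi) => //.
rewrite inE /= /IG_adj; apply/cards1P; exists i; apply/setP => j.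
rewrite !inE tnth_mktuple.
by case: (j == i); case: (tnth _ j).
Qed.

Lemma min_degreeE (G : sgraph) d (x : G) :
  degree x <= d -> (forall y : G, d <= degree y) -> min_degree G = d.
Proof.
move=> xd dmin; rewrite /min_degree; apply/eqP; rewrite eqn_leq; apply/andP; split.
  apply: leq_trans xd; elim: (index_enum G) (mem_index_enum x) => //= y s IHs.
  rewrite inE big_cons => /predU1P [->|/IHs le]; first exact: geq_minl.
  exact: leq_trans (geq_minr _ _) le.
elim/big_ind: _ => [|a b da db|y _]; last exact: dmin.
  (* The default value [#|G|] is also at least [d], since it bounds [degree x]. *)
  by apply: leq_trans (dmin x) _; apply: max_card.
by rewrite leq_min da db.
Qed.

(** * Legal flips *)

(** Only the gap condition at [i] itself could fail. Two ones around [i] within distance [p] cannot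
    exist if [p = 1] or [i = 0]; otherwise the 0 next to [i] would already lie between two close
    ones of [f]. *)
Lemma valid_delete p r f i : valid p r f ->
  [\/ p = 1, i = 0, ~~ f i.-1 | ~~ f i.+1] -> f i -> valid p r (flip f i).
Proof.
move=> [short apart] side fi; rewrite /flip; split=> [j|j m k jm mk kp].
  have [l lr fl] := short j; exists l => //.
  by case: eqP => [E|_]; rewrite ?addbF //; move: fl; rewrite E fi.
case: (j =P i) => [->|ji]; first by rewrite fi.
case: (k =P i) => [->|ki]; first by rewrite fi.
case: (m =P i) => [mi|_]; rewrite !addbF; last exact: apart kp.
move=> fj fk; exfalso; case: side => [p1|i0|/negP[]|/negP[]]; try lia.
  have [<-//|ji1] := eqVneq j i.-1.
  by apply: (apart j _ k) => //; lia.
have [<-//|ki1] := eqVneq k i.+1.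
by apply: (apart j _ k) => //; lia.
Qed.

(** One criterion for all insertions: [[a, b)] is the block after the flip, which may be a lone 1,
    an extended block or two blocks merged into one. *)
Lemma valid_insert p r f a b i : valid p r f -> 0 < p ->
  a <= i < b -> b - a <= r ->
  (forall k, a <= k < b -> k != i -> f k) ->
  (forall k, k < a -> a <= k + p -> ~~ f k) ->
  (forall k, b <= k -> k < b + p -> ~~ f k) ->
  ~~ f i -> valid p r (flip f i).
Proof.
move=> [short apart] p0 aib bar ones zl zr fi; rewrite /flip; split=> [j|j m k jm mk kp].
  have [ja|aj] := ltnP j a.
    have [jr|rj] := ltnP (j + r) a.
      by have [l lr fl] := short j; exists l => //; case: eqP => [|_]; [lia|rewrite addbF].
    exists (a.-1 - j); first lia.
    rewrite subnKC; last lia.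
    by case: eqP => [|_]; [lia | rewrite addbF; apply: zl; lia].
  have [bj|jb] := ltnP b j.
    by have [l lr fl] := short j; exists l => //; case: eqP => [|_]; [lia|rewrite addbF].
  exists (b - j); first lia.
  rewrite subnKC //.
  by case: eqP => [|_]; [lia | rewrite addbF; apply: zr; lia].
case: (m =P i) => [->|mi]; first by rewrite (negbTE fi).
rewrite addbF; case: (j =P i) => ji; case: (k =P i) => ki; rewrite ?addbF; try lia.
- move=> _ fk; apply: ones; last exact/eqP.
  suff: k < b by lia.
  by rewrite ltnNge; apply/negP => bk; have /negP[] := zr k bk ltac:(lia).
- move=> fj _; apply: ones; last exact/eqP.
  suff: a <= j by lia.
  by rewrite leqNgt; apply/negP => bk; have /negP[] := zl j bk ltac:(lia).
exact: apart.
Qed.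

Lemma gap_left p r f a b : valid p r f -> block f a b ->
  forall k, k < a -> a <= k + p -> ~~ f k.
Proof.
move=> [_ apart] [ab ones start_a _] k ka kp; case: start_a => [|fa]; first lia.
have [->//|ka1] := eqVneq k a.-1.
apply/negP => fk; move/negP: fa; apply; apply: (apart k _ a) => //; try lia.
by apply: ones; lia.
Qed.

Lemma gap_right p r f a b : valid p r f -> block f a b ->
  forall k, b <= k -> k < b + p -> ~~ f k.
Proof.
move=> [_ apart] [ab ones _ end_b] k ka kp.
have [->//|ka1] := eqVneq k b.
apply/negP => fk; move/negP: end_b; apply; apply: (apart b.-1 _ k) => //; try lia.
by apply: ones; lia.
Qed.

Lemma block_size p r f a b : valid p r f -> block f a b -> b - a <= r.
Proof.
move=> [short _] [ab ones _ _]; rewrite leqNgt; apply/negP => rab.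
by have [k kr /negP] := short a; apply; apply: ones; lia.
Qed.

(** * Counting in prefixes *)

Definition cnt (P : pred nat) (i : nat) : nat := count P (iota 0 i).

Lemma cntS (P : pred nat) i : cnt P i.+1 = cnt P i + P i.
Proof. by rewrite /cnt -[i.+1]addn1 iotaD count_cat /= addn0. Qed.

Lemma cnt_mono (P : pred nat) i j : i <= j -> cnt P i <= cnt P j.
Proof.
elim: j => [|j IHj]; first by rewrite leqn0 => /eqP->.
rewrite leq_eqVlt => /predU1P[->//|ij]; rewrite cntS; have := IHj ij; lia.
Qed.

Lemma cnt_run (P : pred nat) i j : i <= j -> (forall k, i <= k < j -> P k) ->
  cnt P i + (j - i) <= cnt P j.
Proof.
elim: j => [|j IHj] ij run; first by move: ij; rewrite leqn0 => /eqP->.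
have [ji|{}ij] := ltnP j i; first by (have -> : i = j.+1 by lia); lia.

have {}IHj : cnt P i + (j - i) <= cnt P j.
  by apply: IHj => // k ik; apply: run; lia.
by rewrite cntS run; lia.
Qed.

Lemma cnt_predC (P : pred nat) i : cnt P i + cnt (predC P) i = i.
Proof. by rewrite /cnt count_predC size_iota. Qed.

Lemma cnt_le (P : pred nat) i : cnt P i <= i.
Proof. by have := cnt_predC P i; lia. Qed.

(** * Lower bounds *)

(* For W = 2p + r and p, r > 1, the greatest length of a word with at most d
   neighbours. *)
Definition max_length W d := d./2 * W + odd d.

Lemma max_lengthS W d : 0 < W -> odd d -> (max_length W d.+1).+1 = max_length W d + W.
Proof. by rewrite /max_length /= uphalf_half => _ ->; lia. Qed.

Lemma max_lengthSS W d : max_length W d.+2 = max_length W d + W.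
Proof. by rewrite /max_length /= negbK; lia. Qed.

(** One more neighbour adds 1 or [W - 1] alternately, in either case at least 1. *)
Lemma max_lengthD W d m : 1 < W -> max_length W d + m <= max_length W (d + m).
Proof.
move=> W_gt1; elim: m => [|m IHm]; first by rewrite !addn0.
apply: leq_trans (_ : max_length W (d + m) + 1 <= _); first lia.
rewrite [d + _.+1]addnS /max_length /= uphalf_half; case: (odd _) => /=; lia.
Qed.

Lemma max_length_mono W d e : 1 < W -> d <= e -> max_length W d <= max_length W e.
Proof. by move=> W_gt1 /subnKC <-; have := @max_lengthD W d (e - d) W_gt1; lia. Qed.

Section LowerBound.

Variables (p r n : nat) (f fl : nat -> bool).
Hypotheses (p_gt0 : 0 < p) (r_gt0 : 0 < r) (f_valid : valid p r f).
Hypothesis f_out : forall k, n <= k -> ~~ f k.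
Hypothesis flP : forall k, reflect (k < n /\ valid p r (flip f k)) (fl k).

Local Notation c := (cnt fl).

Lemma f_lt k : f k -> k < n.
Proof. by move=> fk; rewrite ltnNge; apply/negP => /f_out; rewrite fk. Qed.

Lemma block_le a b : block f a b -> b <= n.
Proof. by case=> ab ones _ _; have := @f_lt b.-1; rewrite ones; lia. Qed.

Lemma fl_block a b k : block f a b -> a <= k < b ->
  [\/ p = 1, k = a | k = b.-1] -> fl k.
Proof.
case=> ab ones start_a end_b akb side.
have fk := ones k akb; apply/flP; split; first exact: f_lt.
apply: valid_delete => //; case: side => [->|ka|kb]; first by constructor 1.
  by rewrite ka; case: start_a => ?; [constructor 2|constructor 3].
by constructor 4; rewrite kb prednK //; lia.
Qed.

Lemma fl_isolated k : k < n -> (forall m, k <= m + p -> m <= k + p -> ~~ f m) -> fl k.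
Proof.
move=> kn zero; apply/flP; split=> //.
apply: (@valid_insert p r f k k.+1) => //; try lia.
- by move=> m ? ?; apply: zero; lia.
- by move=> m ? ?; apply: zero; lia.
by apply: zero; lia.
Qed.

(** The gap is taken with [p + 1] zeros, so that [p] of them remain after the extension. *)
Lemma fl_extend_right a b : block f a b -> b < n -> b - a < r ->
  (forall k, b <= k <= b + p -> ~~ f k) -> fl b.
Proof.
move=> bl bn len zero; have [ab ones _ end_b] := bl; apply/flP; split=> //.
apply: (@valid_insert p r f a b.+1) => //; try lia.
- by move=> k ? ?; apply: ones; lia.
- exact: (gap_left f_valid bl).
by move=> k ? ?; apply: zero; lia.
Qed.

Lemma fl_extend_left a b : block f a b -> 0 < a -> b - a < r ->
  (forall k, k < a -> a <= k + p.+1 -> ~~ f k) -> fl a.-1.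
Proof.
move=> bl a_gt0 len zero; have [ab ones _ end_b] := bl; have bn := block_le bl.
apply/flP; split; first lia.
apply: (@valid_insert p r f a.-1 b) => //; try lia.
- by move=> k ? ?; apply: ones; lia.
- by move=> k ? ?; apply: zero; lia.
- exact: (gap_right f_valid bl).
by apply: zero; lia.
Qed.

Lemma fl_no_block : (forall k, ~~ f k) -> c n = n.
Proof.
move=> zero; apply/eqP; rewrite eqn_leq cnt_le /=.
have := @cnt_run fl 0 n (leq0n n); rewrite subn0.
by apply=> k kn; apply: fl_isolated => // m _ _; apply: zero.
Qed.

Lemma fl_zeros_before a k : (forall m, m < a -> ~~ f m) -> a <= n -> k + p < a -> fl k.
Proof. by move=> zero an ka; apply: fl_isolated => [|m ? ?]; [lia|apply: zero; lia]. Qed.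

Lemma fl_zeros_after b k : (forall m, b <= m -> ~~ f m) -> k < n -> b + p <= k -> fl k.
Proof. by move=> zero an ka; apply: fl_isolated => [|m ? ?]; [lia|apply: zero; lia]. Qed.

Lemma fl_zeros_between b a k : (forall m, b <= m < a -> ~~ f m) -> a <= n ->
  b + p <= k -> k + p < a -> fl k.
Proof. by move=> zero an bk ka; apply: fl_isolated => [|m ? ?]; [lia|apply: zero; lia]. Qed.

Lemma gap_size a b a' b' : block f a b -> block f a' b' -> b < a' -> b + p <= a'.
Proof.
move=> bl [ab ones _ _] ba; rewrite leqNgt; apply/negP => lt.
have /negP[] := gap_right f_valid bl (ltnW ba) lt.
by apply: ones; lia.
Qed.

Lemma last_block_out : (forall k, ~~ f k) \/
  exists a b, block f a b /\ forall k, b <= k -> ~~ f k.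
Proof.
have fn := f_out (leqnn n).
case: (last_block fn) => [zero|[a [b [bl _ zero]]]]; [left=> k|right; exists a, b; split=> // k bk].
  by have [?|?] := leqP k n; [apply: zero|apply: f_out; lia].
by have [?|?] := leqP k n; [apply: zero; lia|apply: f_out; lia].
Qed.

(** Each 1 is flippable and pays for itself and [p] positions on either side; any 0 farther away is
    flippable and pays for itself. *)
Lemma single_bound : r = 1 -> n <= (2 * p + 1) * c n.
Proof.
move=> r1; set W := 2 * p + 1.
have inv b a : block f a b -> b + p <= W * c b.
  elim/ltn_ind: b a => b IH a bl; have [ab _ _ _] := bl.
  have an := block_le bl; have len := block_size f_valid bl.
  have cb : c b = (c a).+1.
    have -> : b = a.+1 by lia.
    by rewrite cntS (fl_block bl) ?addn1 //; [lia | constructor 2].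
  (* The flip at [a] pays for the [p] positions before it, for [a], and for the [p] positions after
     it. *)
  suff: a <= W * c a + p by rewrite cb mulnS /W; lia.
  case: (prev_block bl) => [zero|[a' [b' [bl' b'a zero]]]].
    have := @cnt_run fl 0 (a - p) (leq0n _).
    have := @cnt_mono fl (a - p) a (leq_subr _ _).
    have run k : 0 <= k < a - p -> fl k by move=> ?; apply: (fl_zeros_before zero); lia.
    by move=> ? /(_ run); nia.
  have bp := gap_size bl' bl b'a.
  have := IH b' ltac:(lia) a' bl'.
  have [le|lt] := leqP a (b' + 2 * p); first by have := @cnt_mono fl b' a (ltnW b'a); nia.
  have run k : b' + p <= k < a - p -> fl k by move=> ?; apply: (fl_zeros_between zero); lia.
  have {}lt : b' + p <= a - p by lia.
  have := cnt_run lt run.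
  have := @cnt_mono fl b' (b' + p) (leq_addr _ _).
  have := @cnt_mono fl (a - p) a (leq_subr _ _).
  nia.
case: last_block_out => [zero|[a [b [bl zero]]]]; first by rewrite fl_no_block // /W; nia.
have := inv _ _ bl; have bn := block_le bl.
have [le|lt] := leqP n (b + p); first by have := cnt_mono fl bn; nia.
have run k : b + p <= k < n -> fl k by move=> ?; apply: (fl_zeros_after zero); lia.
have := cnt_run (ltnW lt) run.
have := @cnt_mono fl b (b + p) (leq_addr _ _).
nia.
Qed.

(** Two flips pay for [W] positions, a block with [p] zeros on each side. They are the two ends of
    the block, or a lone 1 and an insertion next to it. A lone 1 without such an insertion has on
    each side a gap of exactly [p] or the border of the word, so its single flip has less to
    cover. *)
Lemma wide_gap_bound : 1 < r -> 1 < p -> n <= max_length (2 * p + r) (c n).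
Proof.
move=> r_gt1 p_gt1; move: {-2}(2 * p + r) (erefl (2 * p + r)) => W WE.
have W_gt1 : 1 < W by lia.
have mono d e : d <= e -> max_length W d <= max_length W e by apply: max_length_mono.
have grow d m : max_length W d + m <= max_length W (d + m) by apply: max_lengthD.
have grow0 d : d <= max_length W d by have := grow 0 d; rewrite add0n; lia.
(* For a block ending at [n], the count [c b.+1] used below reaches one position past the word. *)
have c_out : c n.+1 = c n.
  by rewrite cntS; case: flP => [[]|_]; rewrite ?addn0 ?ltnn.
have c_le_n b : b <= n -> c b.+1 <= c n.
  by move=> bn; rewrite -c_out; apply: cnt_mono; lia.
(* The second alternative describes a block consisting of a single 1 with no
   neighbour inserted next to it. *)
have inv b a : block f a b -> b + p <= max_length W (c b.+1) \/
    [/\ b <= max_length W (c b), odd (c b) & b = n \/ exists k, b < k <= b + p /\ f k].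
  elim/ltn_ind: b a => b IH a bl; have [ab _ start_a _] := bl.
  have bn := block_le bl; have len := block_size f_valid bl.
  have fla : fl a by apply: (fl_block bl); [lia | constructor 2].
  have flb : fl b.-1 by apply: (fl_block bl); [lia | constructor 3].
  have ca : c a.+1 = (c a).+1 by rewrite cntS fla addn1.
  have ca1 : c a.-1 <= c a by apply: cnt_mono; lia.
  (* The bound on [a] stops at [c a.-1], so that an insertion at [a.-1] can be credited to this
     block. The second part treats a lone 1 without that insertion. *)
  have before : a <= max_length W (c a.-1) + p /\ (b = a.+1 ->
      0 < a -> ~~ fl a.-1 -> b <= max_length W (c b) /\
         (odd (c b) \/ b + p <= max_length W (c b))).
    case: (prev_block bl) => [zero|[a' [b' [bl' b'a zero]]]].
      split.
        have run k : 0 <= k < a - p -> fl k.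
          by move=> ?; apply: (fl_zeros_before zero); lia.
        have := cnt_run (leq0n (a - p)) run.
        have : c (a - p) <= c a.-1 by apply: cnt_mono; lia.
        have := grow0 (c a.-1); lia.
      move=> ba a_gt0 /negP[]; apply: (fl_extend_left bl) => //; first lia.
      by move=> k ka _; apply: zero.
    have bp := gap_size bl' bl b'a.
    case: (IH b' ltac:(lia) a' bl') => [good|[le odd_c [b'n|[k [b'k fk]]]]]; last first.
    (* The previous block is a lone 1 with one flip. The gap has length exactly [p], so the
       allowance of [p] before [a] covers it. *)
    - have ea : a = b' + p.
        have [ka|ak] := ltnP k a; last lia.
        by have /negP[] := zero k ltac:(lia).
      have cb' : c b' <= c a.-1 by apply: cnt_mono; lia.
      have := mono _ _ cb'; split; first lia.
      move=> ba a_gt0 _.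
      (* Two such lone ones in succession: from an odd count the bound grows by
         [W - 1 >= 2 * p + 1], which covers the gap, the 1 at [a] and [p] further zeros. *)
      have : max_length W (c b').+1 <= max_length W (c b).
        by apply: mono; rewrite ba ca; lia.
      have := max_lengthS (ltnW W_gt1) odd_c; lia.
    - by have := block_le bl'; have := bn; lia.
    have aW : a <= max_length W (c a.-1) + p.
      have cb' : c b'.+1 <= c a.-1 by apply: cnt_mono; lia.
      have [le|lt] := leqP a (b' + 2 * p); first by have := mono _ _ cb'; lia.
      have run k : b' + p <= k < a - p -> fl k.
        by move=> ?; apply: (fl_zeros_between zero); lia.
      have {}lt : b' + p <= a - p by lia.
      have := cnt_run lt run.
      have : c b'.+1 <= c (b' + p) by apply: cnt_mono; lia.
      have : c (a - p) <= c a.-1 by apply: cnt_mono; lia.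
      set x := a - p - (b' + p) => ? ? ?.
      have := mono (c b'.+1 + x) (c a.-1) ltac:(lia).
      have := grow (c b'.+1) x; rewrite /x; lia.
    split=> // ba a_gt0 nfl.
    (* A wider gap would allow the insertion at [a.-1]. *)
    have ea : a = b' + p.
      apply/eqP; rewrite eqn_leq bp andbT leqNgt; apply/negP => lt.
      case/negP: nfl; apply: (fl_extend_left bl) => //; first lia.
      by move=> k ka kp; apply: zero; lia.
    have cb' : c b'.+1 <= c a by apply: cnt_mono; lia.
    have := mono _ _ cb'; rewrite ba ca => le.
    have := grow (c a) 1; rewrite [c a + 1]addn1; split; first lia.
    (* If [c a] is odd, the flip at [a] raises the bound by [W - 1], enough for the next [p] zeros
       as well. *)
    rewrite /=; case odd_c: (odd (c a)); last by left.
    by right; have := max_lengthS (ltnW W_gt1) odd_c; lia.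
  have [aW single] := before.
  (* Two flips among the positions [a.-1] to [b] raise the bound by [W], enough for [p] zeros, at
     most [r] ones and again [p] zeros. *)
  have two_more : c a.-1 + 2 <= c b.+1 -> b + p <= max_length W (c b.+1).
    move=> le; have := mono _ _ le; rewrite addn2 max_lengthSS; lia.
  have [b2|ba] : a.+1 < b \/ b = a.+1 by lia.
    left; apply: two_more.
    have : c a.+1 <= c b.-1 by apply: cnt_mono; lia.
    have : c b <= c b.+1 by apply: cnt_mono.
    have := cntS fl b.-1; rewrite flb prednK; lia.
  have cb1 := cntS fl b.
  case flb1: (fl b); first by left; apply: two_more; rewrite cb1 flb1 ba ca; lia.
  (* The insertion at [b] is illegal, so either the word ends there or a 1 follows within distance
     [p]. *)
  have end_b : b = n \/ exists k, b < k <= b + p /\ f k.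
    have [->|nb] := eqVneq b n; [by left | right].
    have [/existsP[k fk]|none] := boolP [exists k : 'I_p, f (b + k.+1)].
      by exists (b + k.+1); have := ltn_ord k; split=> //; lia.
    have := fl_extend_right bl ltac:(lia) ltac:(lia).
    rewrite flb1 => H; exfalso; have //: false; apply: H => k bk.
    have [->|kb] := eqVneq k b; first by case: bl.
    apply/negP => fk; case/negP: none; apply/existsP.
    have kp : (k - b).-1 < p by lia.
    by exists (Ordinal kp) => /=; rewrite prednK ?subnKC //; lia.
  have [a0|a_gt0] := posnP a.
    right; rewrite ba a0 in end_b *; split=> //; rewrite -a0 ca.
      by have := grow0 (c a).+1; lia.
    by rewrite a0.
  case fla1: (fl a.-1).
    left; apply: two_more; have := cntS fl a.-1; rewrite fla1 prednK //.
    rewrite cb1 flb1 ba ca; lia.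
  have [le [odd_c|]] := single ba a_gt0 (negbT fla1); first by right.
  by left; rewrite cb1 flb1 addn0.
case: last_block_out => [zero|[a [b [bl zero]]]].
  by rewrite fl_no_block //; have := grow0 n.
have bn := block_le bl; have c_bn := c_le_n b bn.
case: (inv _ _ bl) => [good|[le odd_c [<-//|[k [bk fk]]]]]; last first.
  by have /negP[] := zero k ltac:(lia).
have [le|lt] := leqP n (b + p); first by have := mono _ _ c_bn; lia.
have run k : b + p <= k < n -> fl k by move=> ?; apply: (fl_zeros_after zero); lia.
have := cnt_run (ltnW lt) run.
have : c b.+1 <= c (b + p) by apply: cnt_mono; lia.
set x := n - (b + p) => ? ?.
have := mono (c b.+1 + x) (c n) ltac:(lia).
have := grow (c b.+1) x; rewrite /x; lia.
Qed.

(* Charge every unflippable 0 to an adjacent full block, or else to the pair of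
   short blocks around it, whose lengths then add up to at least r. *)
Lemma unit_gap_bound : p = 1 -> r * uphalf (n - c n) <= c n.
Proof.
move=> p1; pose u := cnt (predC fl).
have cu k : c k + u k = k by apply: cnt_predC.
have mul x y : x <= y -> r * x <= r * y by move=> xy; rewrite leq_mul2l xy orbT.
have half_u k : (u k)./2 * 2 <= u k <= (u k)./2 * 2 + 1 by lia.
have uphalf_u k : u k <= uphalf (u k) * 2 <= u k + 1 by lia.
have uS k : u k.+1 = u k + ~~ fl k by rewrite /u cntS.
have u_run x y : x <= y -> (forall k, x <= k < y -> fl k) -> u y <= u x.
  by move=> xy run; have := cnt_run xy run; have := cu x; have := cu y; lia.
have c_mono x y : x <= y -> c x <= c y by apply: cnt_mono.
(* Since [(u b)./2.+1] equals [uphalf (u b).+1], a full block leaves room for one more unflippable 0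
   after it. For a short block the last inequality keeps its [b - a] flips in reserve, in case it
   and the next short block surround an unflippable 0. *)
have inv b a : block f a b ->
    (b - a = r -> r * (u b)./2.+1 <= c b) /\
    (b - a < r -> r * uphalf (u b) <= c b /\ r * (u b)./2 + (b - a) <= c b).
  elim/ltn_ind: b a => b IH a bl; have [ab ones _ _] := bl.
  have an := block_le bl; have len := block_size f_valid bl.
  have run k : a <= k < b -> fl k.
    by move=> ak; apply: (fl_block bl ak); constructor 1.
  have c_b := cnt_run (ltnW ab) run; have u_b := u_run _ _ (ltnW ab) run.
  have := half_u b; have := uphalf_u b.
  case: (prev_block bl) => [zero|[a' [b' [bl' b'a zero]]]].
    have u_a1 : u a.-1 = 0.
      apply/eqP; rewrite -leqn0; apply: (u_run 0) => // k ka.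
      by apply: (fl_zeros_before zero); lia.
    have [a0|a_gt0] := posnP a.
      rewrite a0 /= in u_a1 u_b; have : (u b)./2 = 0 by lia.
      have : uphalf (u b) = 0 by lia.
      by move=> -> -> _ _; rewrite muln0 muln1; lia.
    have := uS a.-1; rewrite prednK // u_a1 => u_a _ _; split=> [full|short].
      have -> : (u b)./2 = 0 by case: (fl _) in u_a; lia.
      lia.
    have fla1 : fl a.-1 by apply: (fl_extend_left bl) => // k ka _; apply: zero.
    rewrite fla1 in u_a; have -> : (u b)./2 = 0 by lia.
    have -> : uphalf (u b) = 0 by lia.
    lia.
  have [fullP shortP] := IH b' ltac:(lia) a' bl'.
  have [ab' ones' _ _] := bl'; have len' := block_size f_valid bl'.
  have c_ba := c_mono _ _ (ltnW b'a).
  (* For [p = 1] the inner zeros of the gap are flippable, so only its two ends matter; the factor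
     [(b'.+1 < a)] avoids counting a gap of a single 0 twice. *)
  have u_a : u a <= u b' + ~~ fl b' + (b'.+1 < a) * ~~ fl a.-1.
    rewrite -uS; have [lt|le] := ltnP b'.+1 a; last by (have -> : a = b'.+1 by lia); lia.
    have := uS a.-1; rewrite prednK; last lia.
    have : u a.-1 <= u b'.+1.
      apply: u_run => [|k bk]; first lia.
      by apply: (fl_zeros_between zero); lia.
    lia.
  have fl_left : b - a < r -> b'.+1 < a -> fl a.-1.
    move=> short lt; apply: (fl_extend_left bl) => //; first lia.
    by move=> k ka kp; apply: zero; lia.
  have fl_right : b' - a' < r -> b'.+1 < a -> fl b'.
    move=> short lt; apply: (fl_extend_right bl') => //; first lia.
    by move=> k bk; apply: zero; lia.
  have fl_merge : b' - a' + (b - a) < r -> a = b'.+1 -> fl b'.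
    move=> short ea; apply/flP; split; first lia.
    apply: (valid_insert (a := a') (b := b)) => //; try lia.
    - move=> k akb kb; have [kb'|bk'] := ltnP k b'; first by apply: ones'; lia.
      by apply: ones; lia.
    - exact: (gap_left f_valid bl').
    - exact: (gap_right f_valid bl).
    by apply: zero; lia.
  have := half_u b'; have := uphalf_u b'.
  have [full'|short'] : b' - a' = r \/ b' - a' < r by lia.
    move=> _ hu' xu hu; have {fullP} := fullP full'; split=> [full|short].
      have := mul (u b)./2.+1 (u b')./2.+2 ltac:(lia).
      by rewrite [r * _.+2]mulnS; lia.
    have u_a1 : u a <= u b' + 1.
      have [lt|le] := ltnP b'.+1 a; last lia.
      by move: u_a; rewrite fl_left //; lia.
    have := mul (uphalf (u b)) (u b')./2.+1 ltac:(lia).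
    have := mul (u b)./2 (u b')./2.+1 ltac:(lia).
    lia.
  move=> xu' hu' xu hu; have {shortP} [P1 P2] := shortP short'.
  have u_a1 : u a <= u b' + 1.
    have [lt|le] := ltnP b'.+1 a; last lia.
    by move: u_a; rewrite fl_right //; lia.
  split=> [full|short].
    have := mul (u b)./2.+1 (uphalf (u b')).+1 ltac:(lia).
    by rewrite [r * (uphalf _).+1]mulnS; lia.
  have := mul (u b)./2 (uphalf (u b')) ltac:(lia).
  have [le|lt] := leqP (u a) (u b').
    have := mul (uphalf (u b)) (uphalf (u b')) ltac:(lia); lia.
  (* A new unflippable 0 between short blocks is the whole gap, and filling it would give more than
     [r] ones in a row. *)
  have [ea nfl] : a = b'.+1 /\ ~~ fl b'.
    have [lt'|le] := ltnP b'.+1 a.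
      by move: u_a; rewrite fl_left // fl_right //=; lia.
    split; first lia.
    by move: u_a; case: (fl b') => //; lia.
  have := mul (uphalf (u b)) (u b')./2.+1 ltac:(lia).
  rewrite [r * _.+1]mulnS.
  have : r <= b' - a' + (b - a).
    by rewrite leqNgt; apply: contra nfl => ?; apply: fl_merge.
  lia.
have un : n - c n = u n by have := cu n; lia.
rewrite un; case: last_block_out => [zero|[a [b [bl zero]]]].
  have := cu n; rewrite fl_no_block // => u0; (have -> : u n = 0 by lia); lia.
have bn := block_le bl; have len := block_size f_valid bl.
have [fullP shortP] := inv _ _ bl; have := c_mono _ _ bn.
have hb := half_u b; have xb := uphalf_u b; have xn := uphalf_u n.
have u_n : u n <= u b + ((b < n) && ~~ fl b).
  have [lt|le] := ltnP b n; last by (have -> : b = n by lia); lia.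
  rewrite -uS; apply: u_run => // k bk.
  by apply: (fl_zeros_after zero); lia.
have [full|short] : b - a = r \/ b - a < r by lia.
  have := fullP full.
  have /mul : uphalf (u n) <= (u b)./2.+1 by case: (_ && _) u_n; lia.
  lia.
have flb : b < n -> fl b.
  by move=> lt; apply: (fl_extend_right bl) => // k bk; apply: zero; lia.
have {}u_n : u n <= u b.
  by move: u_n; have [lt|_] := ltnP b n; rewrite /= ?flb //; lia.
have := shortP short; have /mul : uphalf (u n) <= uphalf (u b) by lia.
lia.
Qed.

End LowerBound.

(** * Words of minimum degree *)

(** Next to the full run, the new 1 makes [r + 1] ones in a row. Farther away, the 0 bounding the
    run lies between two ones at distance at most [p]. *)
Lemma not_valid_insert_near_full p r f e i : valid p r f -> 0 < r ->
  (forall k, e <= k < e + r -> f k) -> ~~ f i ->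
  (i < e <= i + p) || (e + r <= i < e + r + p) -> ~ valid p r (flip f i).
Proof.
move=> [short apart] r_gt0 full fi near [short' apart'].
have notin k : e <= k < e + r -> k != i by move=> /full fk; apply: contraNneq fi => <-.
have flipE k : k != i -> flip f i k = f k by rewrite /flip => /negbTE->; rewrite addbF.
have flip_i : flip f i i by rewrite /flip eqxx addbT.
have flip_full k : e <= k < e + r -> flip f i k.
  by move=> ek; rewrite flipE ?full ?notin.
have [near_l|near_r] := orP near.
  have [ei|ei] := eqVneq e i.+1.
    have [l lr /negP[]] := short' i.
    by case: l lr => [|l] lr; rewrite ?addn0 //; apply: flip_full; lia.
  have fe1 : ~~ f e.-1.
    have [[|l] lr] := short e.-1; first by rewrite addn0.
    by rewrite full //; lia.
  move/negP: fe1; apply; rewrite -flipE; last lia.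
  by apply: (apart' i _ e) => //; [lia | lia | lia | apply: flip_full; lia].
have [ei|ei] := eqVneq i (e + r).
  have [l lr /negP[]] := short' e; have [->|lr'] := eqVneq l r; first by rewrite -ei.
  by apply: flip_full; lia.
have fe : ~~ f (e + r).
  have [l lr] := short e; have [->//|lr'] := eqVneq l r.
  by rewrite full //; lia.
move/negP: fe; apply; rewrite -flipE; last lia.
by apply: (apart' (e + r).-1 _ i) => //; [lia | lia | lia | apply: flip_full; lia].
Qed.

Section Witness.

Variables (p r n W K t : nat).
Hypotheses (p_gt0 : 0 < p) (r_gt0 : 0 < r) (WE : W = 2 * p + r).
Hypotheses (nE : n = K * W + t) (t_lt : t < W).

(** For [t <= r] the tail consists of ones only. For [t > r] its full block has at most [p] zeros
    before it and, as [t < 2 * p + r], fewer than [p] after it. *)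
Local Notation s := (minn p (t - r)).

(* A word of minimum degree is (0^p 1^r 0^p)^K followed by a tail of length t,
   which is 0^s 1^(min t r) 0^(t - s - min t r). *)
Definition witness_start (q : nat) : nat := if q < K then p else s.

Definition witness (i : nat) : bool :=
  (i < n) && (witness_start (i %/ W) <= i %% W < witness_start (i %/ W) + r).

Lemma witnessE q j : j < W ->
  witness (q * W + j) = (q * W + j < n) && (witness_start q <= j < witness_start q + r).
Proof.
by move=> jW; rewrite /witness modnMDl (modn_small jW) divnMDl ?(divn_small jW) ?addn0 //; lia.
Qed.

Lemma offsetP i : exists q j, j < W /\ i = q * W + j.
Proof.
by exists (i %/ W), (i %% W); split; [rewrite ltn_pmod //; lia | exact: divn_eq].
Qed.

Lemma period_cases q j : j < W -> q * W + j < n ->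
  [/\ q < K, witness_start q = p & q * W + W <= K * W] \/
  [/\ q = K, witness_start q = s & j < t].
Proof.
move=> jW; rewrite {1}nE /witness_start.
have [qK|Kq|->] := ltngtP q K.
- by move=> _; left; split=> //; rewrite -mulSnr leq_mul2r qK orbT.
- have : K.+1 * W <= q * W by rewrite leq_mul2r Kq orbT.
  by rewrite mulSnr; lia.
by move=> lt; right; split=> //; rewrite ltn_add2l in lt.
Qed.

Lemma witness_valid : valid p r witness.
Proof.
split=> [i|i m j im mj jip].
  have [wi|] := boolP (witness i); last by exists 0; rewrite ?addn0.
  have [q [x [xW ei]]] := offsetP i; rewrite {}ei in wi *.
  move: wi; rewrite witnessE // => /andP[lt x_in].
  have st : witness_start q <= p by rewrite /witness_start; case: ifP => _; lia.
  exists (witness_start q + r - x); first lia.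
  have -> : q * W + x + (witness_start q + r - x) = q * W + (witness_start q + r) by lia.
  by rewrite witnessE; lia.
have [q [x [xW ei]]] := offsetP i; rewrite {}ei in im jip *.
have [jW|Wj] := ltnP j (q * W + W).
  have -> : j = q * W + (j - q * W) by lia.
  have -> : m = q * W + (m - q * W) by lia.
  rewrite !witnessE; lia.
(* Here [j] lies beyond the period of [i]. In the tail that is past the end of the word; otherwise
   the [p] final zeros of the period put [j] more than [p] away. *)
rewrite witnessE // => /andP[lt x_in] wj.
have [q' [y [yW ej]]] := offsetP j.
have jn : j < n by case/andP: wj.
have [[qK st le]|[qK st xt]] := period_cases xW lt; last by rewrite qK in Wj; lia.
by rewrite st in x_in; lia.
Qed.

Lemma witness_zero i : i < n -> ~~ witness i -> ~ valid p r (flip witness i).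
Proof.
move=> i_lt wi.
have [q [x [xW ei]]] := offsetP i; rewrite ei witnessE // in i_lt wi *.
apply: (@not_valid_insert_near_full p r witness (q * W + witness_start q)) => //.
- exact: witness_valid.
- move=> k kq; have -> : k = q * W + (k - q * W) by lia.
  by case: (period_cases xW i_lt) => [[qK st le]|[qK st xt]];
    rewrite st in kq wi *; rewrite witnessE ?st; lia.
- by rewrite witnessE.
by case: (period_cases xW i_lt) => [[qK st le]|[qK st xt]]; rewrite st in wi *; lia.
Qed.

Lemma witness_in_ones i : witness i ->
  i \in [seq q * W + p + j | q <- iota 0 K, j <- iota 0 r]
        ++ iota (K * W + s) (minn t r).
Proof.
have [q [x [xW ->]]] := offsetP i; rewrite witnessE // => /andP[lt x_in].
rewrite mem_cat; apply/orP.
have [[qK st le]|[qK st xt]] := period_cases xW lt; [left|right]; rewrite st in x_in.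
  apply/allpairsP; exists (q, x - p); rewrite /= !mem_iota; split; lia.
by rewrite mem_iota qK; lia.
Qed.

(** Repetitions in the list do no harm, as only its length is used. The truncation by [minn t 2]
    drops both ends of an empty tail and merges the equal ends of a tail of length 1. *)
Lemma witness_block_end i : witness i -> i = 0 \/ ~~ (witness i.-1 && witness i.+1) ->
  i \in [seq q * W + p + j | q <- iota 0 K, j <- [:: 0; r.-1]]
        ++ take (minn t 2) [:: K * W + s; K * W + s + (minn t r).-1].
Proof.
have [q [x [xW ->]]] := offsetP i; rewrite witnessE // => /andP[lt x_in] side.
rewrite mem_cat; apply/orP.
have inner : 0 < x -> x.+1 < W -> ~~ [&& witness_start q <= x.-1, q * W + x.+1 < n
    & x.+1 < witness_start q + r].
  move=> x_gt0 x1W; case: side => [|]; first lia.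
  have -> : (q * W + x).-1 = q * W + x.-1 by lia.
  rewrite -addnS !witnessE //; last lia.
  by apply: contra => /and3P[? ? ?]; lia.
have [[qK st le]|[eq st xt]] := period_cases xW lt; [left|right]; rewrite st in x_in inner.
  have [xp|xp] : x = p \/ x = p + r.-1 by have := inner; lia.
    by apply/allpairsP; exists (q, 0); rewrite /= !mem_iota ?inE; split; lia.
  by apply/allpairsP; exists (q, r.-1); rewrite /= !mem_iota ?inE ?eqxx ?orbT; split; lia.
have [xs|xs] : x = s \/ x = s + (minn t r).-1 by have := inner; rewrite eq in lt *; lia.
  rewrite eq xs; case E : (minn t 2) => [|m] /=; first lia.
  by rewrite inE eqxx.
case E : (minn t 2) => [|[|m]] /=; first lia.
  by rewrite inE eq; apply/eqP; lia.
by rewrite !inE eq; apply/orP; right; apply/eqP; lia.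
Qed.

Lemma witness_vertex : exists x : IG n p r,
  degree x <= r * K + minn t r /\ (1 < p -> degree x <= 2 * K + minn t 2).
Proof.
pose w := [tuple witness i | i < n].
have wE : nth false w =1 witness.
  move=> k; have [kn|nk] := ltnP k n; last first.
    by rewrite nth_default ?size_tuple // /witness ltnNge nk.
  by rewrite -(tnth_nth _ _ (Ordinal kn)) tnth_mktuple.
have w_ok : IG_word p r w.
  by apply/IG_wordP; apply: eq_valid witness_valid => k; rewrite wE.
exists (exist _ w w_ok); rewrite degree_flippable /=.
have flipP k : flippable p r w k -> witness k /\ valid p r (flip witness k).
  move=> /flippableP[kn v].
  have {}v : valid p r (flip witness k) by apply: eq_valid v => m; rewrite /flip wE.
  by split=> //; apply/negPn/negP => wk; apply: (witness_zero kn wk v).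
have bound (l : seq nat) : (forall k, flippable p r w k -> k \in l) ->
    count (flippable p r w) (iota 0 n) <= size l.
  move=> sub; rewrite -size_filter; apply: uniq_leq_size.
    by rewrite filter_uniq ?iota_uniq.
  by move=> k; rewrite mem_filter => /andP[/sub].
split=> [|p_gt1].
  apply: leq_trans (bound _ (fun k fk => witness_in_ones (flipP k fk).1)) _.
  by rewrite size_cat size_allpairs !size_iota mulnC.
(* Deleting a 1 inside a block leaves two ones at distance 2 around a 0, illegal for [p > 1]. *)
have side k : flippable p r w k -> k = 0 \/ ~~ (witness k.-1 && witness k.+1).
  move=> /flipP[wk [_ apart]].
  have [->|k_gt0] := posnP k; [by left | right]; apply/negP => /andP[wk1 wk2].
  have := apart k.-1 k k.+1; rewrite /flip eqxx wk wk1 wk2.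
  have -> : (k.-1 == k) = false by lia.
  have -> : (k.+1 == k) = false by lia.
  by move=> /(_ ltac:(lia) ltac:(lia) ltac:(lia) isT isT).
apply: leq_trans (bound _ (fun k fk => witness_block_end (flipP k fk).1 (side k fk))) _.
by rewrite size_cat size_allpairs size_iota size_takel ?geq_minr // mulnC.
Qed.

End Witness.

(** * The three formulas for the minimum degree *)

Import Order.TTheory GRing.Theory Num.Theory.

Lemma ceil_divn (m w d : nat) : m <= w * d < m + w ->
  Num.ceil (m%:R / w%:R : rat)%R = Posz d.
Proof.
move=> /andP[le lt]; have w_gt0 : (0 < w%:R :> rat)%R by rewrite ltr0n; lia.
apply: ceil_def; rewrite ltr_pdivlMr // ler_pdivrMr // rmorphB /= !pmulrn.
rewrite -!pmulrn mulrBl mul1r ltrBlDr -natrM -natrD ltr_nat ler_nat.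
by rewrite [(d * w)%N]mulnC lt le.
Qed.

Lemma degree_single p n (x : IG n p 1) : 0 < p -> n <= (2 * p + 1) * degree x.
Proof.
move=> p_gt0; rewrite degree_flippable.
apply: (@single_bound p 1 n (nth false (val x))) => // [|k nk|k].
- exact/IG_wordP/(valP x).
- by rewrite nth_default // size_tuple.
exact: flippableP.
Qed.

Lemma degree_unit_gap r n (x : IG n 1 r) : 0 < r ->
  r * uphalf (n - degree x) <= degree x.
Proof.
move=> r_gt0; rewrite degree_flippable.
apply: (@unit_gap_bound 1 r n (nth false (val x))) => // [|k nk|k].
- exact/IG_wordP/(valP x).
- by rewrite nth_default // size_tuple.
exact: flippableP.
Qed.

Lemma degree_wide_gap p r n (x : IG n p r) : 1 < p -> 1 < r ->
  n <= max_length (2 * p + r) (degree x).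
Proof.
move=> p_gt1 r_gt1; rewrite degree_flippable.
apply: (@wide_gap_bound p r n (nth false (val x))) => // [|||k nk|k]; try lia.
- exact/IG_wordP/(valP x).
- by rewrite nth_default // size_tuple.
exact: flippableP.
Qed.

Theorem theorem5p4 (p r n : nat) (hp : 1 <= p) (hr : 1 <= r) (hn : 1 <= n) :
  (r = 1 -> 1 <= p ->
     Posz (min_degree (IG n p r))
     = Num.ceil (n%:R / (2 * p + 1)%:R : rat)%R)
  /\
  (2 <= r -> p = 1 ->
     let t := n %% (r + 2) in
     (0 <= t <= r - 1 -> min_degree (IG n p r) = r * (n %/ (r + 2)) + t)
     /\ (t = r \/ t = r + 1 ->
           min_degree (IG n p r) = r * (n %/ (r + 2)) + r))
  /\
  (2 <= r -> 2 <= p ->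
     let t := n %% (2 * p + r) in
     (t = 0 \/ t = 1 ->
        min_degree (IG n p r) = 2 * (n %/ (r + 2 * p)) + t)
     /\ (2 <= t <= r + 2 * p - 1 ->
           min_degree (IG n p r) = 2 * (n %/ (r + 2 * p)) + 2)).
Proof.
pose W := 2 * p + r; pose K := n %/ W; pose t := n %% W.
have tW : t < W by rewrite ltn_pmod // /W; lia.
have nE : n = K * W + t by exact: divn_eq.
have [x [deg_x deg_x2]] := @witness_vertex p r n W K t hp hr erefl nE tW.
split; [|split].
- move=> r1 _; subst r; set M := K + minn t 1.
  have -> : min_degree (IG n p 1) = M.
    apply: (min_degreeE (x := x)) => [|y]; first by rewrite mul1n in deg_x.
    rewrite leqNgt; apply/negP => lt; have := degree_single y hp.
    have : W * (degree y).+1 <= W * M by rewrite leq_mul2l lt orbT.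
    by rewrite -/W /M mulnDr mulnS; nia.
  by rewrite (@ceil_divn n W M) // /M mulnDr; nia.
- move=> r_gt1 p1; subst p; rewrite /= addnC -[2]muln1 -/W -/K -/t.
  have -> : min_degree (IG n 1 r) = r * K + minn t r.
    apply: (min_degreeE (x := x)) => // y.
    rewrite leqNgt; apply/negP => lt; have := degree_unit_gap y hr.
    (* A smaller degree leaves at least [2 * K + 1] unflippable positions, which forces degree at
       least [r * (K + 1)], a contradiction. *)
    have : K.+1 <= uphalf (n - degree y) by rewrite /W in nE; nia.
    by rewrite -(leq_pmul2l hr) mulnS; lia.
  by rewrite /W in tW; split; lia.
move=> r_gt1 p_gt1; rewrite /= [r + _]addnC -/W -/K -/t.
have -> : min_degree (IG n p r) = 2 * K + minn t 2.
  apply: (min_degreeE (x := x)) => [|y]; first exact: deg_x2.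
  rewrite leqNgt; apply/negP => lt; have := degree_wide_gap y p_gt1 r_gt1.
  rewrite -/W; have W_gt1 : 1 < W by rewrite /W; lia.
  apply/negP; rewrite -ltnNge [X in _ < X]nE.
  have : degree y <= (2 * K + minn t 2).-1 by lia.
  move=> /(max_length_mono W_gt1) /leq_ltn_trans; apply.
  have even k : max_length W (2 * k) = k * W.
    by rewrite mul2n /max_length odd_double doubleK addn0.
  have odd k : max_length W (2 * k).+1 = k * W + 1.
    by rewrite mul2n /max_length /= odd_double uphalf_double.
  (* The lengths to compare with [n] are [(K - 1) * W + 1], [K * W] and [K * W + 1] for [t = 0],
     [t = 1] and [t >= 2]; if [K = t = 0], no degree is smaller. *)
  move: (K) (t) lt => k [|[|m]] lt; last by rewrite (minn_idPr (_ : 2 <= m.+2)) // addn2 odd; lia.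
    case: k lt => [|k] lt; first lia.
    by rewrite mulnS min0n addn0 add2n /= odd mulSn; lia.
  by rewrite (minn_idPl (_ : 1 <= 2)) // addn1 even; lia.
by split; lia.
Qed.
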